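(* Let $G$ be a connected graph with $n\ge 3$ vertices. Then there exists a vertex $v\in V(G)$ such that $|EM(v)|=2$ if and only if $G=D_1(n)$, or $G=D_2(n)$, or $G=A_d$ for some $d\geq 3$ (that is, $G$ is isomorphic to a graph of one of these forms).
   Context: Graphs are finite, undirected and simple. $d_G(x,y)$ is the distance between $x$ and $y$ in $G$, and $G-e$ is the graph obtained from $G$ by deleting the edge $e$ (distances between different components are $\infty$). For a vertex $x$ of $G$, $EM(x)$ is the set of edges $e\in E(G)$ such that there exists a vertex $y\in V(G)$ with $d_G(x,y)\neq d_{G-e}(x,y)$. Graphs $D_1(n)$ and $D_2(n)$: let $D$ be any graph of order $n-3$ (possibly with no vertices when $n=3$). $D_1(n)$ has vertex set $\{v,u_1,u_2\}\cup V(D)$ and edge set $\{u_1w,u_2w \mid w\in V(D)\}\cup\{u_1v,u_2v,u_1u_2\}\cup E(D)$. $D_2(n)$ has vertex set $\{v,u_1,u_2\}\cup V(D)$ and edge set $\{u_1w,u_2w\mid w\in V(D)\}\cup\{u_1v,u_2v\}\cup E(D)$. Graphs $A_d$ ($d\ge 3$): $A_d$ denotes a graph in which the vertex $v$ has eccentricity $d$ and such that the following holds. For each $2\le i\le d$ let $B_i$ be a graph, with $|V(B_i)|\ge 2$ for $2\le i\le d-1$, and let $B_1$ be a graph with vertex set $\{u_1,u_2\}$. Then $V(A_d)=\{v,u_1,u_2\}\cup\bigcup_{2\le i\le d}V(B_i)$ and $$E(A_d)=\{vu_1,vu_2\}\cup\Bigl(\bigcup_{2\le i\le d}E(B_i)\Bigr)\cup\Bigl(\bigcup_{2\le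 i\le d}\ \bigcup_{v^{i}\in V(B_i)}E_{A_d}[v^{i},V(B_{i-1})]\Bigr),$$ where $E_{A_d}[v^i,V(B_{i-1})]$ is the set of edges of $A_d$ between $v^i$ and $V(B_{i-1})$, and $|E_{A_d}[v^{i},V(B_{i-1})]|\ge 2$ for every $v^i\in V(B_i)$, $2\le i\le d$. That is, each vertex of $B_i$ has at least two neighbours in $B_{i-1}$.
   Formalization: In E(A_d) the union of the E(B_i) is taken over 1 ≤ i ≤ d instead of 2 ≤ i ≤ d, so that u_1u_2 may be an edge of A_d; with the displayed formula, under which u_1u_2 is never an edge, the claim is false. *)

(* Defs.v *)
From mathcomp Require Import all_boot.

Set Implicit Arguments.
Unset Strict Implicit.
Unset Printing Implicit Defensive.

Record sgraph := SGraph {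
  svertex :> finType;
  sedge : rel svertex;
  sedge_sym : symmetric sedge;
  sedge_irr : irreflexive sedge
}.
Arguments SGraph : clear implicits.
Arguments sedge {s}.

Definition edges (G : sgraph) : {set {set G}} :=
  [set [set p.1; p.2] | p in [set p : G * G | sedge p.1 p.2]].

Definition connected (G : sgraph) : Prop := forall x y : G, connect sedge x y.

Definition isomorphic (G H : sgraph) : Prop :=
  exists2 f : G -> H, bijective f & forall x y, sedge (f x) (f y) = sedge x y.

Section Deletion.
Variables (G : sgraph) (e : {set G}).

Definition del_rel : rel G := fun x y => sedge x y && ([set x; y] != e).

Lemma del_sym : symmetric del_rel.
Proof. by move=> x y; rewrite /del_rel sedge_sym setUC. Qed.

Lemma del_irr : irreflexive del_rel.
Proof. by move=> x; rewrite /del_rel sedge_irr. Qed.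

Definition del_edge : sgraph := SGraph G del_rel del_sym del_irr.
End Deletion.

Section Distance.
Variable G : sgraph.

Definition has_walk (x y : G) (k : nat) : bool :=
  [exists p : k.-tuple G, path sedge x p && (last x p == y)].

Lemma connect_walk (x y : G) : connect sedge x y -> exists k, has_walk x y k.
Proof.
case/connectP=> p xp ->; exists (size p).
by apply/existsP; exists (in_tuple p); rewrite xp eqxx.
Qed.

(* Distances live in option nat, where None stands for infinity. *)
Definition dist (x y : G) : option nat :=
  if @idP (connect sedge x y) is ReflectT xy
  then Some (ex_minn (connect_walk xy)) else None.

Definition ecc (x : G) : option nat :=
  if [forall y, isSome (dist x y)]
  then Some (\max_(y : G) odflt 0 (dist x y)) else None.

End Distance.

Definition EM (G : sgraph) (x : G) : {set {set G}} :=
  [set e in edges G | [exists y : G, dist x y != @dist (del_edge e) x y]].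

(* The vertex v is None, the vertices u_1 and u_2 are Some (inl _), and a vertex
   w of D is Some (inr w); the boolean u12 says whether u_1 u_2 is an edge. *)
Section DGraph.
Variables (u12 : bool) (D : sgraph).

Definition Drel : rel (option (bool + D)) := fun x y =>
  match x, y with
  | None, Some (inl _) | Some (inl _), None => true
  | Some (inl a), Some (inl b) => u12 && (a != b)
  | Some (inl _), Some (inr _) | Some (inr _), Some (inl _) => true
  | Some (inr w), Some (inr w') => sedge w w'
  | _, _ => false
  end.

Lemma Drel_sym : symmetric Drel.
Proof. by move=> [[a|w]|] [[b|w']|] //=; rewrite 1?eq_sym // sedge_sym. Qed.

Lemma Drel_irr : irreflexive Drel.
Proof. by move=> [[a|w]|] //=; rewrite ?eqxx ?andbF // sedge_irr. Qed.

Definition Dgraph : sgraph :=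
  SGraph (option (bool + D)%type) Drel Drel_sym Drel_irr.
End DGraph.

Definition D1 (D : sgraph) : sgraph := Dgraph true D.
Definition D2 (D : sgraph) : sgraph := Dgraph false D.

Definition is_D1 (n : nat) (G : sgraph) : Prop :=
  exists2 D : sgraph, #|D| = n - 3 & isomorphic G (D1 D).

Definition is_D2 (n : nat) (G : sgraph) : Prop :=
  exists2 D : sgraph, #|D| = n - 3 & isomorphic G (D2 D).

Definition inner_edges (H : sgraph) (X : {set H}) : {set {set H}} :=
  [set e in edges H | e \subset X].

Definition edges_to (H : sgraph) (x : H) (Y : {set H}) : {set {set H}} :=
  [set e in edges H | [exists y in Y, e == [set x; y]]].

(* B i is the vertex set of the graph B_i. As the B i are pairwise disjoint,
   the edges of H inside B i are exactly those of B_i, so E(B_i) is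
   inner_edges (B i). The graph B_1 on {u_1, u_2} is arbitrary and contributes
   its edges too, so u_1 u_2 may or may not be an edge: this is why the first
   union in A_edges starts at i = 1. *)
Record A_structure (d : nat) (H : sgraph) (v u1 u2 : H) (B : nat -> {set H}) :
    Prop := AStructure {
  A_ecc : ecc v = Some d;
  A_distinct : [/\ v != u1, v != u2 & u1 != u2];
  A_B1 : B 1 = [set u1; u2];
  A_card : forall i, 2 <= i <= d.-1 -> 2 <= #|B i|;
  A_disj0 : forall i, 2 <= i <= d -> [disjoint [set v; u1; u2] & B i];
  A_disj : forall i j, 2 <= i < j -> j <= d -> [disjoint B i & B j];
  A_vertices : [set: H] = [set v; u1; u2] :|: \bigcup_(2 <= i < d.+1) B i;
  A_edges : edges H =
    [set [set v; u1]; [set v; u2]]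
    :|: \bigcup_(1 <= i < d.+1) inner_edges (B i)
    :|: \bigcup_(2 <= i < d.+1) \bigcup_(x in B i) edges_to x (B i.-1);
  A_parents : forall i (x : H), 2 <= i <= d -> x \in B i ->
    2 <= #|edges_to x (B i.-1)|
}.

Definition is_A (d : nat) (G : sgraph) : Prop :=
  exists (H : sgraph) (v u1 u2 : H) (B : nat -> {set H}),
    A_structure d v u1 u2 B /\ isomorphic G H.

(* Main.v *)
Require Import Defs.
From mathcomp Require Import all_boot.

(** An edge belongs to [EM v] exactly when it joins some vertex [x] to its only
    neighbour at distance [d(v, x) - 1] from [v]: deleting any other edge leaves
    every vertex with a neighbour one step closer to [v].  Hence [#|EM v|] counts
    the vertices having exactly one "parent" in the layering by distance from
    [v].  All neighbours of [v] are such vertices.  If there are two of them, all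
    deeper vertices have at least two parents, which gives [D_1], [D_2] or [A_d]
    according to the depth.  If there is only one, [G] is a path on three
    vertices, that is [D_2] with an empty [D]. *)

Set Implicit Arguments.
Unset Strict Implicit.
Unset Printing Implicit Defensive.

(** * Edges as unordered pairs, walks and distances *)

Lemma mem_edges (G : sgraph) (x y : G) : ([set x; y] \in edges G) = sedge x y.
Proof.
apply/imsetP/idP => [[[a b]]|xy]; last by exists (x, y); rewrite ?inE.
rewrite inE /= => ab E; have nab : a != b by apply: contraTneq ab => ->; rewrite sedge_irr.
have: a \in [set x; y] by rewrite E set21.
have: b \in [set x; y] by rewrite E set22.
case/set2P=> Eb /set2P[] Ea; subst a b; rewrite ?eqxx // in nab *.
by rewrite sedge_sym.
Qed.

Lemma edgesP (G : sgraph) (e : {set G}) :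
  reflect (exists x y, sedge x y /\ e = [set x; y]) (e \in edges G).
Proof.
apply: (iffP imsetP) => [[[a b]]|[x [y [xy ->]]]].
  by rewrite inE /= => ab ->; exists a, b.
by exists (x, y); rewrite ?inE.
Qed.

Lemma has_walk0 (G : sgraph) (x y : G) : has_walk x y 0 = (x == y).
Proof.
apply/existsP/idP => [[p]|xy]; first by rewrite tuple0.
by exists [tuple].
Qed.

Lemma has_walkS (G : sgraph) (x y : G) k :
  has_walk x y k.+1 = [exists z, has_walk x z k && sedge z y].
Proof.
apply/existsP/existsP => [[p /andP[xp /eqP lp]]|[z /andP[/existsP[p]]]].
  move: (tval p) (size_tuple p) xp lp => q; case/lastP: q => [|q z] //.
  rewrite size_rcons => -[sq]; rewrite rcons_path last_rcons => /andP[xq e] <-.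
  exists (last x q); rewrite e andbT.
  by apply/existsP; exists (tcast sq (in_tuple q)); rewrite val_tcast xq /=.
move=> /andP[xp /eqP lp] zy.
have sp : size (rcons p y) == k.+1 by rewrite size_rcons size_tuple.
by exists (Tuple sp); rewrite /= rcons_path xp lp zy last_rcons /=.
Qed.

(** Replaces the proof-dependent match in [dist] by minimality among walk lengths. *)
Lemma distP (G : sgraph) (x y : G) k :
  dist x y = Some k <-> has_walk x y k /\ (forall j, has_walk x y j -> k <= j).
Proof.
have walk_connect j : has_walk x y j -> connect sedge x y.
  by case/existsP=> p /andP[xp /eqP lp]; apply/connectP; exists p.
rewrite /dist; case: {-}_ / idP => [xy|nxy]; last first.
  by split=> // -[/walk_connect].
case: ex_minnP => m wm min_m; split=> [[<-] //|[wk min_k]].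
by congr Some; apply/eqP; rewrite eqn_leq min_m //= min_k.
Qed.

(** * Levels and parents with respect to a root *)

Definition parents (G : sgraph) (l : G -> nat) (x : G) : {set G} :=
  [set y | sedge x y && (l x == (l y).+1)].

(* These conditions force [l] to be the distance from [v], yet they can be checked
   without computing distances and survive the deletion of most edges. *)
Record leveling (G : sgraph) (v : G) (l : G -> nat) : Prop := Leveling {
  level_root : forall x, (l x == 0) = (x == v);
  level_edge : forall x y, sedge x y -> l x <= (l y).+1;
  level_parent : forall x, x != v -> 0 < #|parents l x|
}.

(** Stated from the root and edge conditions alone, so that it still applies after deleting an edge
    that leaves a vertex without a parent. *)
Lemma leveling_walk (G : sgraph) (v : G) (l : G -> nat) (x : G) (k : nat) :
  l v = 0 -> (forall x y : G, sedge x y -> l x <= (l y).+1) ->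
  has_walk v x k -> l x <= k.
Proof.
move=> lv lE; elim: k x => [|k IHk] x; first by rewrite has_walk0 => /eqP<-; rewrite lv.
rewrite has_walkS => /existsP[z /andP[/IHk lz zx]].
by apply: leq_trans (lE x z _) _; rewrite 1?sedge_sym.
Qed.

(** Following parents from [x] down to [v] gives a walk of length [l x]; an edge raises the level by
    at most one, so no walk is shorter. *)
Lemma leveling_dist (G : sgraph) (v : G) (l : G -> nat) (x : G) :
  leveling v l -> dist v x = Some (l x).
Proof.
case=> l0 lE lP; have lv : l v = 0 by apply/eqP; rewrite l0.
apply/distP; split=> [|j]; last exact: leveling_walk.
move Ek: (l x) => k; elim: k x Ek => [|k IHk] x lx.
  by rewrite has_walk0 eq_sym -l0 lx.
have /lP/card_gt0P[y] : x != v by rewrite -l0 lx.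
rewrite inE lx eqSS => /andP[xy /eqP ly].
by rewrite has_walkS; apply/existsP; exists y; rewrite IHk // sedge_sym.
Qed.

(** Connectedness makes every distance finite, so the default 0 is never reached. The last but one
    vertex of a shortest walk is a parent. *)
Lemma dist_leveling (G : sgraph) (v : G) :
  connected G -> leveling v (fun x => odflt 0 (dist v x)).
Proof.
move=> Gconn.
have dP x : exists k, dist v x = Some k.
  have [k wk] := connect_walk (Gconn v x).
  exists (ex_minn (connect_walk (Gconn v x))); apply/distP.
  by case: ex_minnP.
have wE x y k : sedge x y -> has_walk v y k -> has_walk v x k.+1.
  by move=> xy wk; rewrite has_walkS; apply/existsP; exists y; rewrite wk sedge_sym.
split=> [x|x y xy|x xv].
- have [k dk] := dP x; rewrite dk /=; case/distP: dk => wk min_k.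
  apply/eqP/eqP => [k0|xv]; first by move: wk; rewrite k0 has_walk0 => /eqP.
  by apply/eqP; rewrite -leqn0 min_k // has_walk0 xv.
- have [[k dk] [j dj]] := (dP x, dP y); rewrite dk dj /=.
  by case/distP: dj => /(wE _ _ _ xy) wx _; case/distP: dk => _; apply.
- have [k dk] := dP x; case/distP: (dk) => wk min_k.
  case: k => [|k] in dk wk min_k *.
    by move: wk xv; rewrite has_walk0 eq_sym => ->.
  move: wk; rewrite has_walkS => /existsP[y /andP[wy yx]].
  apply/card_gt0P; exists y; rewrite inE sedge_sym yx dk /= eqSS.
  have [j dj] := dP y; rewrite dj /=; case/distP: dj => wj min_j.
  rewrite eqn_leq min_j // andbT -ltnS min_k //.
  by apply: wE wj; rewrite sedge_sym.
Qed.

(** * The set [EM v] in terms of parents *)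

(** When [p] is the only parent of [x], the set [x |: parents l x] is the edge [[set x; p]]. *)
Lemma EM_leveling (G : sgraph) (v : G) (l : G -> nat) :
  leveling v l ->
  EM v = [set x |: parents l x | x in [set x | #|parents l x| == 1]].
Proof.
move=> lev; have [l0 lE lP] := lev.
have lv : l v = 0 by apply/eqP; rewrite l0.
have delE e (x y : del_edge e) : sedge x y = @sedge G x y && ([set x; y] != e) by [].
have lE' e (x y : del_edge e) : sedge x y -> l x <= (l y).+1.
  by rewrite delE => /andP[/lE].
apply/setP=> e; rewrite inE; apply/andP/imsetP => [[/edgesP[a [b [ab Ee]]]]|[x]]; last first.
  rewrite inE => /cards1P[p xP] ->; rewrite xP.
  have: p \in parents l x by rewrite xP set11.
  rewrite inE => /andP[xp /eqP lx]; split; first by rewrite mem_edges.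
  (* Had [x] kept its distance, the vertex before it on a shortest walk would be a parent joined to
     [x] by another edge than the deleted one, yet [p] is the only parent. *)
  apply/existsP; exists x; rewrite (leveling_dist _ lev); apply/eqP => /esym/distP[wx _].
  move: wx; rewrite lx has_walkS => /existsP[y /andP[wy]].
  rewrite delE => /andP[yx ne].
  have ly := leveling_walk lv (lE' _) wy.
  have : y \in parents l x.
    by rewrite inE sedge_sym yx eqn_leq lE 1?sedge_sym // lx ltnS ly.
  by rewrite xP inE => /eqP yp; rewrite yp setUC eqxx in ne.
case/existsP=> y dy; apply/imsetP; apply: contraTT dy => nS; rewrite negbK (leveling_dist _ lev).
rewrite eq_sym; apply/eqP.
(* If [e] is not such an edge, [l] remains a leveling after the deletion, so no distance from [v]
   changes. *)
suff lev' : @leveling (del_edge e) v l by exact: leveling_dist.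
split=> // [x z|x xv]; first exact: lE'.
have /card_gt0P[p pP] := lP x xv.
have keep q : q \in parents l x -> [set x; q] != e -> 0 < #|@parents (del_edge e) l x|.
  by rewrite inE => /andP[xq lq] ne; apply/card_gt0P; exists q; rewrite inE delE xq ne lq.
have [Ep|] := eqVneq [set x; p] e; last exact: keep.
(* Here [e] joins [x] to its parent [p]; were [p] the only parent, [e] would be one of the excluded
   edges. *)
have [|/card_gt1P[q [r [qP rP qr]]]] := leqP #|parents l x| 1.
  rewrite leq_eqVlt ltnNge lP // orbF => P1; case/negP: nS; apply/imsetP; exists x; rewrite ?inE //.
  by rewrite -Ep; case/cards1P: P1 pP => s -> /set1P->.
have other s : s \in parents l x -> s != p -> [set x; s] != e.
  rewrite inE => /andP[xs _] sp; rewrite -Ep; apply: contraNneq sp => E.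
  have: s \in [set x; p] by rewrite -E set22.
  by case/set2P=> [Es|->//]; rewrite Es sedge_irr in xs.
(* Of two distinct parents [q] and [r], at least one differs from [p]. *)
have [qp|qp] := eqVneq q p; last by apply: (keep q) (other q _ _).
by apply: (keep r) => //; apply: other; rewrite // -qp eq_sym.
Qed.

(** Distinct vertices give distinct edges: otherwise each would be the parent of the other. *)
Lemma card_EM_leveling (G : sgraph) (v : G) (l : G -> nat) :
  leveling v l -> #|EM v| = #|[set x | #|parents l x| == 1]|.
Proof.
move=> lev; rewrite (EM_leveling lev) card_in_imset // => x y _ _ E.
have: x \in y |: parents l y by rewrite -E setU11.
have: y \in x |: parents l x by rewrite E setU11.
rewrite !inE; case/predU1P=> [-> //|/andP[_ /eqP lx]].
case/predU1P=> [//|/andP[_ /eqP ly]].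
by move/eqP: lx; rewrite ly -addn2 -[X in X == _]addn0 eqn_add2l.
Qed.

(** A leveling provides some parent, so it suffices that [p] is alone on the preceding level. *)
Lemma parents_set1 (G : sgraph) (v : G) (l : G -> nat) (p x : G) :
    leveling v l -> 0 < l x -> (forall y, l x = (l y).+1 -> y = p) ->
  parents l x = [set p].
Proof.
move=> lev lx uniq; have sub : parents l x \subset [set p].
  by apply/subsetP=> y; rewrite !inE => /andP[_ /eqP/uniq->].
apply/eqP; rewrite eqEcard sub cards1 (level_parent lev) //.
by rewrite -(level_root lev) -lt0n.
Qed.

Lemma parents_level1 (G : sgraph) (v : G) (l : G -> nat) (x : G) :
  leveling v l -> l x = 1 -> parents l x = [set v].
Proof.
move=> lev lx; apply: (parents_set1 lev) => [|y]; rewrite lx // => -[ly].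
by apply/eqP; rewrite -(level_root lev) -ly.
Qed.

(** * A sufficient condition on levels, and the graphs [D_1] and [D_2] *)

(** The root has no parent, vertices of level 1 have one and deeper vertices at least two. *)
Lemma EM_two (G : sgraph) (v : G) (l : G -> nat) :
    leveling v l -> (forall x, 2 <= l x -> 2 <= #|parents l x|) ->
  #|[set x | l x == 1]| = 2 -> #|EM v| = 2.
Proof.
move=> lev l2 <-; rewrite (card_EM_leveling lev); apply: eq_card => x.
rewrite !inE; case lx: (l x) => [|[|k]].
- rewrite eq_sym; apply/eqP => /esym/eqP/cards1P[y E].
  by have := set11 y; rewrite -E inE lx andbF.
- by rewrite (parents_level1 lev lx) cards1.
- by have := l2 x; rewrite lx => /(_ isT); case: #|_| => [|[|]].
Qed.

(** Pulls the leveling back as [l \o f], so that only the explicit models have to be examined. *)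
Lemma isomorphic_EM_two (G H : sgraph) (v : H) (l : H -> nat) :
    isomorphic G H -> leveling v l ->
    (forall x, 2 <= l x -> 2 <= #|parents l x|) ->
  #|[set x | l x == 1]| = 2 -> exists v' : G, #|EM v'| = 2.
Proof.
case=> f bij_f fE [l0 lE lP] l2 l1; have [g fK gK] := bij_f.
have card_pre (A : {set H}) : #|f @^-1: A| = #|A|.
  by apply: on_card_preimset; apply: onW_bij.
have parE x : #|parents (l \o f) x| = #|parents l (f x)|.
  by rewrite -card_pre; apply: eq_card => y; rewrite !inE fE.
exists (g v); apply: (@EM_two _ _ (l \o f)).
- split=> [x|x y|x xv] /=; first by rewrite l0 (can2_eq fK gK).
  + by rewrite -fE => /lE.
  + by rewrite parE lP // -(inj_eq (can_inj gK)) fK.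
- by move=> x /= /l2; rewrite parE.
- by rewrite -l1 -card_pre; apply: eq_card => x; rewrite !inE.
Qed.

(** The levels are 0, 1 and 2 whether or not [u_1 u_2] is an edge, so both families are treated at
    once. *)
Lemma Dgraph_EM_two (G D : sgraph) (u12 : bool) :
  isomorphic G (Dgraph u12 D) -> exists v : G, #|EM v| = 2.
Proof.
pose l (x : Dgraph u12 D) := match x with None => 0 | Some (inl _) => 1 | _ => 2 end.
have par2 w : 2 <= #|parents l (Some (inr w))|.
  apply/card_gt1P; exists (Some (inl true)), (Some (inl false)).
  by rewrite !inE.
move/(@isomorphic_EM_two G (Dgraph u12 D) None l); apply.
- split=> [[[a|w]|]|[[a|w]|] [[b|w']|]|[[a|w]|]] //= _.
  + by apply/card_gt0P; exists None; rewrite inE.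
  + exact: ltnW.
- by move=> [[a|w]|].
- have -> : [set x | l x == 1] = Some @: (inl @: [set: bool]).
    apply/setP=> x; rewrite inE; case: x => [[a|w]|] /=.
    + by apply/esym/imset_f/imset_f.
    + by apply/esym/imsetP => -[? /imsetP[? _ ->]].
    + by apply/esym/imsetP => -[].
  by rewrite !card_imset ?cardsT ?card_bool //; [exact: inl_inj|exact: Some_inj].
Qed.

(** Serves the converse direction: [D] is the subgraph induced on the vertices other than [v], [u1]
    and [u2]. *)
Lemma isomorphic_Dgraph (G : sgraph) (v u1 u2 : G) :
    v != u1 -> v != u2 -> u1 != u2 -> sedge v u1 -> sedge v u2 ->
    (forall w, w \notin [set v; u1; u2] ->
       [/\ ~~ sedge v w, sedge u1 w & sedge u2 w]) ->
  exists2 D : sgraph, #|D| = #|G| - 3 & isomorphic G (Dgraph (sedge u1 u2) D).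
Proof.
move=> vu1 vu2 u12 Ev1 Ev2 rest.
pose T : finType := {x : G | x \notin [set v; u1; u2]}.
pose r : rel T := fun x y => sedge (val x) (val y).
have r_sym : symmetric r by move=> x y; apply: sedge_sym.
have r_irr : irreflexive r by move=> x; apply: sedge_irr.
pose D := SGraph T r r_sym r_irr.
pose g (x : Dgraph (sedge u1 u2) D) : G := match x with
  | None => v | Some (inl a) => if a then u1 else u2 | Some (inr w) => val w end.
have valN (w : T) : [/\ val w != v, val w != u1 & val w != u2].
  by have := valP w; rewrite !inE !negb_or => /andP[/andP[]].
have g_inj : injective g.
  move=> [[[]|w]|] [[[]|w']|] //= E; try by move: E vu1 vu2 u12 => ->; rewrite eqxx.
  all: try by [have [] /= := valN w; rewrite E eqxx | have [] /= := valN w'; rewrite -E eqxx].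
  by congr (Some (inr _)); apply: val_inj.
have g_surj y : exists x, g x = y.
  have [|yN] := boolP (y \in [set v; u1; u2]).
    by rewrite !inE -orbA => /or3P[]/eqP->; [exists None|exists (Some (inl true))|exists (Some (inl false))].
  by exists (Some (inr (Sub y yN : T))).
(* The map [g] out of the model is given by cases; its inverse is chosen pointwise from
   surjectivity. *)
have [h hP] := fin_all_exists g_surj.
have gK : cancel g h by move=> x; apply: g_inj; apply: hP.
have cardG : #|G| = #|Dgraph (sedge u1 u2) D| by apply: bij_eq_card; exists g.
exists D.
  by rewrite cardG card_option card_sum card_bool -addSn addKn.
exists h; first by exists g.
move=> x y; rewrite -{2}[x]hP -{2}[y]hP; move: (h x) (h y) => {x y}.
have restE (w : T) : (sedge v (sval w) = false) * sedge u1 (sval w) * sedge u2 (sval w).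
  by have [/negbTE] := rest _ (valP w).
have restE' (w : T) : (sedge (sval w) v = false) * sedge (sval w) u1 * sedge (sval w) u2.
  by rewrite !(sedge_sym (sval w)) !restE.
by move=> [[[]|w]|] [[[]|w']|] //=; rewrite ?restE ?restE' ?sedge_irr ?andbT ?andbF // sedge_sym.
Qed.

(** * The layers of a graph [A_d] as levels *)

Lemma mem_bigcup_nat (T : finType) (m n : nat) (F : nat -> {set T}) (x : T) :
  reflect (exists2 i, m <= i < n & x \in F i) (x \in \bigcup_(m <= i < n) F i).
Proof.
have -> : (x \in \bigcup_(m <= i < n) F i) = has (fun i => x \in F i) (index_iota m n).
  by elim: (index_iota m n) => [|i r IHr]; rewrite ?big_nil ?big_cons inE //= IHr.
by apply: (iffP hasP) => -[i iP xF]; exists i; rewrite // mem_index_iota in iP *.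
Qed.

Lemma edges_toE (G : sgraph) (x : G) (Y : {set G}) :
  edges_to x Y = [set [set x; y] | y in [set y in Y | sedge x y]].
Proof.
apply/setP=> e; rewrite inE; apply/andP/imsetP => [[eE /existsP[y /andP[yY /eqP Ee]]]|[y]].
  by exists y; rewrite // inE yY -mem_edges -Ee.
rewrite inE => /andP[yY xy] ->; rewrite mem_edges; split=> //.
by apply/existsP; exists y; rewrite yY eqxx.
Qed.

(** Turns the edge count in [A_parents] into a count of neighbours, hence of parents. *)
Lemma card_edges_to (G : sgraph) (x : G) (Y : {set G}) :
  #|edges_to x Y| = #|[set y in Y | sedge x y]|.
Proof.
rewrite edges_toE card_in_imset // => y z; rewrite !inE => /andP[_ xy] _ E.
have: y \in [set x; z] by rewrite -E set22.
by case/set2P=> // yx; rewrite yx sedge_irr in xy.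
Qed.

Lemma A_EM_two (G : sgraph) (d : nat) : 3 <= d -> is_A d G -> exists v : G, #|EM v| = 2.
Proof.
move=> d3 [H [v [u1 [u2 [B [[_ [vu1 vu2 u12] B1 _ disj0 disj vertE edgeE parE] isoGH]]]]]].
have d1 : 0 < d by apply: leq_trans d3.
(* [A_structure] does not fix [B 0], so the root is supplied as layer 0. *)
pose L i := if i is 0 then [set v] else B i.
have Lex x : exists i, i <= d /\ x \in L i.
  have: x \in [set: H] by rewrite inE.
  rewrite vertE => /setUP[|/mem_bigcup_nat[[|i] /andP[_ id] xB]] //; last by exists i.+1.
  case/setUP=> [/set2P[]|/set1P] ->.
  - by exists 0; rewrite set11.
  - by exists 1; rewrite /L B1 set21.
  - by exists 1; rewrite /L B1 set22.
have [l lP] := fin_all_exists Lex.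
(* Disjointness makes the layer index unique, so the chosen [l] is the level function. *)
have Ldisj i j : i < j -> j <= d -> [disjoint L i & L j].
  case: i => [|[|i]] ij jd; last by case: j ij jd => // j ij jd; apply: (disj i.+2 j.+1).
    case: j ij jd => [|[|j]] // _ jd.
      by rewrite disjoints1 /L B1 !inE negb_or vu1.
    by apply: disjointWl (disj0 j.+2 jd); rewrite sub1set !inE eqxx.
  case: j ij jd => [|[|j]] // _ jd.
  apply: disjointWl (disj0 j.+2 jd); rewrite /L B1.
  by apply/subsetP=> x; rewrite !inE => /orP[]->; rewrite ?orbT.
have lE x i : i <= d -> x \in L i -> l x = i.
  move=> id xi; have [ld xl] := lP x.
  have [li|il|//] := ltngtP (l x) i.
    by have /disjointFr/(_ xl) := Ldisj _ _ li id; rewrite xi.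
  by have /disjointFr/(_ xi) := Ldisj _ _ il ld; rewrite xl.
have lv : l v = 0 by apply: lE; rewrite ?set11.
have lu1 : l u1 = 1 by apply: lE; rewrite // /L B1 set21.
have lu2 : l u2 = 1 by apply: lE; rewrite // /L B1 set22.
(* Each of the three kinds of edges in [A_edges] joins vertices of equal or consecutive levels. *)
have level_edge x y : sedge x y -> l x <= (l y).+1.
  rewrite -mem_edges edgeE => /setUP[/setUP[/set2P E|]|].
  - suff: x \in [set v; u1; u2].
      by rewrite !inE -orbA => /or3P[]/eqP->; rewrite ?lv ?lu1 ?lu2.
    have: x \in [set x; y] by rewrite set21.
    by case: E => -> /set2P[]->; rewrite !inE eqxx ?orbT.
  - case/mem_bigcup_nat=> -[//|i] /= id; rewrite inE => /andP[_ /subsetP sub].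
    by rewrite !(lE _ i.+1) // sub ?set21 ?set22.
  - case/mem_bigcup_nat=> -[|[|i]] //= id /bigcupP[z zB].
    rewrite edges_toE => /imsetP[w]; rewrite inE => /andP[wB _] E.
    have lz : l z = i.+2 by apply: lE.
    have lw : l w = i.+1 by apply: lE => //; apply: ltnW.
    have: x \in [set z; w] by rewrite -E set21.
    have: y \in [set z; w] by rewrite -E set22.
    by case/set2P=> -> /set2P[]->; rewrite ?lz ?lw ?leqnSn ?(leqW (leqnSn _)).
have par2 x : 2 <= l x -> 2 <= #|parents l x|.
  move=> lx2; have [ld xl] := lP x.
  have xB : x \in B (l x) by case: (l x) lx2 xl.
  apply: leq_trans (parE (l x) x _ xB) _; first by rewrite lx2.
  rewrite card_edges_to; apply/subset_leq_card/subsetP=> y; rewrite !inE => /andP[yB ->] /=.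
  case: (l x) lx2 ld yB => [|[|k]] // _ kd yB.
  by rewrite (lE y k.+1) //; apply: ltnW.
have level0 x : (l x == 0) = (x == v).
  apply/eqP/eqP => [lx|->//]; have [_] := lP x.
  by rewrite lx => /set1P.
have level1 : [set x | l x == 1] = [set u1; u2].
  apply/setP=> x; rewrite inE -B1; apply/eqP/idP => [lx|]; last exact: (lE x 1).
  by have [_] := lP x; rewrite lx.
apply: isomorphic_EM_two isoGH _ (par2) _; last by rewrite level1 cards2 u12.
split=> // x; rewrite -level0 -lt0n leq_eqVlt => /predU1P[lx|/par2/ltnW//].
apply/card_gt0P; exists v; rewrite inE lv -lx andbT sedge_sym -mem_edges edgeE.
have: x \in [set u1; u2] by rewrite -level1 inE -lx.
by case/set2P=> ->; rewrite !inE eqxx ?orbT.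
Qed.

(** * From [#|EM v| = 2] to the shape of the graph *)

(** Passing to a parent lowers the level by exactly one, so no level is skipped. *)
Lemma level_down (G : sgraph) (v : G) (l : G -> nat) (x : G) (k : nat) :
  leveling v l -> k <= l x -> exists y, l y = k.
Proof.
move=> lev; move Em: (l x) => m; elim: m x Em => [|m IHm] x lx.
  by rewrite leqn0 => /eqP->; exists x.
rewrite leq_eqVlt => /predU1P[->|]; first by exists x.
have /(level_parent lev)/card_gt0P[y] : x != v by rewrite -(level_root lev) lx.
by rewrite inE lx eqSS => /andP[_ /eqP ly]; apply: (IHm y).
Qed.

(* Just below a layer with a single vertex, every vertex has a single parent.  As only
   two vertices do, the layers are [v], [u] and one further vertex [w]; the
   centre of the [D] graph is then [u], not [v]. *)
Lemma EM_two_pendant (G : sgraph) (v u : G) (l : G -> nat) :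
    leveling v l -> 3 <= #|G| -> #|EM v| = 2 -> [set x | l x == 1] = [set u] ->
  exists2 D : sgraph, #|D| = #|G| - 3 & exists b, isomorphic G (Dgraph b D).
Proof.
move=> lev G3; rewrite (card_EM_leveling lev); set S := [set x | _] => S2 L1.
(* Applied with [u] as [x]: two distinct deeper vertices with a single parent would be too many. *)
have three x y z : x \in S -> y \in S -> z \in S -> l x < l y -> y != z -> l x < l z -> False.
  move=> xS yS zS xy yz xz; suff: 2 < #|S| by rewrite S2.
  apply/card_gt2P; exists x, y, z; split; split=> //.
    by apply: contraTneq xy => ->; rewrite ltnn.
  by apply: contraTneq xz => ->; rewrite ltnn.
have lu : l u = 1 by apply/eqP; have := set11 u; rewrite -L1 inE.
have L2 x : l x = 2 -> parents l x = [set u].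
  move=> lx; apply: (parents_set1 lev) => [|y]; rewrite lx // => -[ly].
  by apply/set1P; rewrite -L1 inE -ly.
have uS : u \in S by rewrite inE (parents_level1 lev lu) cards1.
have L2S x : l x = 2 -> x \in S by move=> lx; rewrite inE L2 // cards1.
have L2_uniq x y : l x = 2 -> l y = 2 -> x = y.
  move=> lx ly; apply/eqP; apply: contraT => xy.
  by case: (three u x y); rewrite ?(L2S _ lx) ?(L2S _ ly) ?lu ?lx ?ly.
(* A vertex [t] of level 3 would have the only vertex [w] of level 2 as its single parent, which
   puts [u], [w] and [t] in [S]. *)
have l_le2 x : l x <= 2.
  rewrite leqNgt; apply/negP => /(level_down lev)[t lt].
  have [w lw] : exists w, l w = 2 by apply: (level_down (x := t) lev); rewrite lt.
  have tS : t \in S.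
    rewrite inE (parents_set1 (p := w) lev) ?cards1 ?lt // => y [ly].
    exact: L2_uniq.
  case: (three u w t); rewrite ?(L2S _ lw) ?lu ?lw ?lt //.
  by apply: contra_eqT lw => /negPn/eqP->; rewrite lt.
have lv : l v = 0 by apply/eqP; rewrite (level_root lev).
have level12 x : x != v -> x != u -> l x = 2.
  rewrite -(level_root lev) => lx0 xu.
  have lx1 : l x != 1 by apply: contraNneq xu => lx; rewrite -in_set1 -L1 inE lx.
  by move: (l_le2 x) lx0 lx1; case: (l x) => [|[|[|]]].
have [w wv wu] : exists2 w, w != v & w != u.
  have /subsetPn[w _] : ~~ ([set: G] \subset [set v; u]).
    by apply: contraL G3 => /subset_leq_card; rewrite cardsT cards2 -leqNgt => /leq_trans; apply; case: eqP.
  by rewrite !inE negb_or => /andP[]; exists w.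
have lw : l w = 2 by apply: level12.
have uv : u != v by rewrite -(level_root lev) lu.
have Euv : sedge u v by have := set11 v; rewrite -(parents_level1 lev lu) inE => /andP[].
have Euw : sedge u w.
  by rewrite sedge_sym; have := set11 u; rewrite -(L2 w lw) inE => /andP[].
rewrite eq_sym in wv; rewrite eq_sym in wu.
have [|D cD iso] := isomorphic_Dgraph uv wu wv Euv Euw _.
  (* No fourth vertex exists: it would have level 2 and hence equal [w]. *)
  move=> x; rewrite !inE !negb_or => /andP[/andP[xu xv] xw].
  by case/eqP: xw; apply: L2_uniq => //; apply: level12.
by exists D => //; exists (sedge v w).
Qed.

(** The levels themselves serve as the layers [B i]. *)
Lemma level_A_structure (G : sgraph) (v u1 u2 : G) (l : G -> nat) (d : nat) :
    3 <= d -> leveling v l -> (forall x, l x <= d) -> (exists x, l x = d) ->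
    u1 != u2 -> [set x | l x == 1] = [set u1; u2] ->
    (forall x, 2 <= l x -> 2 <= #|parents l x|) ->
  A_structure d v u1 u2 (fun i => [set x | l x == i]).
Proof.
move=> d3 lev l_le [t lt] u12 L1 par2; have [l0 lE lP] := lev.
have lv : l v = 0 by apply/eqP; rewrite l0.
have lu1 : l u1 = 1 by apply/eqP; have := set21 u1 u2; rewrite -L1 inE.
have lu2 : l u2 = 1 by apply/eqP; have := set22 u1 u2; rewrite -L1 inE.
have vE x : sedge v x = (l x == 1).
  apply/idP/eqP => [vx|lx].
    apply/eqP; rewrite eqn_leq -[X in _ <= X.+1]lv lE 1?sedge_sym //= lt0n l0.
    by apply: contraTneq vx => ->; rewrite sedge_irr.
  have := set11 v; rewrite -(parents_level1 lev lx) inE sedge_sym.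
  by case/andP.
split=> //=.
- rewrite /ecc; case: forallP => [_|[]]; last by move=> x; rewrite (leveling_dist _ lev).
  congr Some; apply/eqP; rewrite eqn_leq; apply/andP; split.
    by apply/bigmax_leqP => x _; rewrite (leveling_dist _ lev) /= l_le.
  by apply: (bigmax_sup t) => //; rewrite (leveling_dist _ lev) /= lt.
- by split; rewrite // eq_sym -l0 ?lu1 ?lu2.
(* Since [i] is at most [d.-1], level [i.+1] is inhabited; the parents of any vertex there are at
   least two vertices of level [i]. *)
- move=> i /andP[i2 id].
  have [y ly] : exists y, l y = i.+1.
    apply: (level_down (x := t) lev); rewrite lt.
    by case: d d3 id {l_le lt} => // k _.
  apply: leq_trans (par2 y _) _; first by rewrite ly leqW.
  by apply/subset_leq_card/subsetP=> z; rewrite !inE ly eqSS eq_sym => /andP[].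
- move=> i /andP[i2 _]; rewrite disjoint_subset; apply/subsetP=> x.
  by rewrite !inE -orbA => /or3P[]/eqP->; rewrite ?lv ?lu1 ?lu2; case: i i2 => [|[|]].
- move=> i j /andP[_ ij] _; rewrite disjoint_subset; apply/subsetP=> x.
  by rewrite !inE => /eqP->; rewrite ltn_eqF.
- apply/setP=> x; rewrite inE; apply/esym; rewrite inE orbC.
  apply/orP; have [lx2|] := leqP 2 (l x).
    by left; apply/mem_bigcup_nat; exists (l x); rewrite ?inE ?lx2 /= ?ltnS.
  case lx: (l x) => [|[|]] // _; right.
    by rewrite !inE -l0 lx.
  by rewrite -setUA -L1 !inE lx orbT.
- have up x y : sedge x y -> l x = (l y).+1 -> [set x; y] \in
      [set [set v; u1]; [set v; u2]]
      :|: \bigcup_(2 <= i < d.+1) \bigcup_(x in [set x | l x == i])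
            edges_to x [set x | l x == i.-1].
    move=> xy lx; case ly: (l y) lx => [|k] lx.
      have -> : y = v by apply/eqP; rewrite -l0 ly.
      have: x \in [set u1; u2] by rewrite -L1 inE lx.
      by case/set2P=> ->; rewrite setUC !inE eqxx ?orbT.
    apply/setUP; right; apply/mem_bigcup_nat; exists k.+2; first by rewrite /= ltnS -lx l_le.
    apply/bigcupP; exists x; first by rewrite inE lx.
    by rewrite edges_toE; apply: imset_f; rewrite !inE ly eqxx.
  apply/setP=> e; apply/idP/idP => [/edgesP[x [y [xy ->]]]|].
    (* Brings the edges between different levels together, as in [up]; the edges inside a level come
       last. *)
    rewrite setUAC.
    have [lxy|lyx|lxy] := ltngtP (l x) (l y).
    + apply/setUP; left; rewrite setUC; apply: up; rewrite 1?sedge_sym //.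
      by apply/eqP; rewrite eqn_leq lxy lE // sedge_sym.
    + apply/setUP; left; apply: up => //.
      by apply/eqP; rewrite eqn_leq lyx lE.
    + apply/setUP; right; apply/mem_bigcup_nat; exists (l x).
        (* An edge inside a level avoids level 0, which contains only [v]. *)
        rewrite ltnS l_le andbT lt0n; apply: contraTneq xy => lx.
        have -> : x = v by apply/eqP; rewrite -l0 lx.
        by rewrite vE -lxy lx.
      rewrite inE mem_edges xy; apply/subsetP=> z.
      by case/set2P=> ->; rewrite inE ?lxy.
  case/setUP=> [/setUP[/set2P[]->|]|].
  + by rewrite mem_edges vE lu1.
  + by rewrite mem_edges vE lu2.
  + by case/mem_bigcup_nat=> i _; rewrite inE => /andP[].
  + by case/mem_bigcup_nat=> i _ /bigcupP[x _]; rewrite inE => /andP[].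
- move=> i x /andP[i2 _]; rewrite inE => /eqP lx.
  rewrite card_edges_to; apply: leq_trans (par2 x _) _; first by rewrite lx.
  apply/subset_leq_card/subsetP=> y; rewrite !inE lx => /andP[-> /eqP->] /=.
  by rewrite eqxx.
Qed.

Lemma isomorphic_refl (G : sgraph) : isomorphic G G.
Proof. by exists id => //; exists id. Qed.

(** * The equivalence, by the size of the first level and the depth *)

Theorem theorem4p11 (n : nat) (G : sgraph) (n_ge3 : 3 <= n)
    (cardG : #|G| = n) (Gconn : connected G) :
  (exists v : G, #|EM v| = 2) <->
  is_D1 n G \/ is_D2 n G \/ (exists2 d : nat, 3 <= d & is_A d G).
Proof.
subst n; split; last first.
  by case=> [[D _]|[[D _]|[d d3]]]; [exact: Dgraph_EM_two.. | exact: A_EM_two].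
case=> v EM2.
have DE : (exists2 D : sgraph, #|D| = #|G| - 3 & exists b, isomorphic G (Dgraph b D)) ->
    is_D1 #|G| G \/ is_D2 #|G| G \/ (exists2 d : nat, 3 <= d & is_A d G).
  by case=> D cD [[] iso]; [left|right; left]; exists D.
pose l x := odflt 0 (dist v x); have lev : leveling v l by apply: dist_leveling.
have [l0 lE lP] := lev.
have := EM2; rewrite (card_EM_leveling lev); set S := [set x | _] => S2.
have L1S : [set x | l x == 1] \subset S.
  by apply/subsetP=> x; rewrite !inE => /eqP/(parents_level1 lev)->; rewrite cards1.
(* Level 1 has two, one or no vertices; the last is impossible, since any vertex other than [v]
   forces level 1 to be inhabited. *)
have := subset_leq_card L1S; rewrite S2 leq_eqVlt => /predU1P[L12|]; last first.
  rewrite ltnS leq_eqVlt => /orP[/cards1P[u L1]|].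
    by apply: DE; apply: EM_two_pendant lev n_ge3 EM2 L1.
  rewrite ltnS leqn0 cards_eq0 => /eqP L1.
  have /subsetPn[w _] : ~~ ([set: G] \subset [set v]).
    by apply: contraL n_ge3 => /subset_leq_card; rewrite cardsT cards1 -leqNgt => /leq_trans; apply.
  rewrite inE -l0 -lt0n => /(level_down lev)[x lx].
  by have := in_set0 x; rewrite -L1 inE lx.
have SE : S = [set x | l x == 1].
  by apply/esym/eqP; rewrite eqEcard L1S S2 L12.
have par2 x : 2 <= l x -> 2 <= #|parents l x|.
  move=> lx2; have lx0 : x != v by rewrite -l0; case: (l x) lx2.
  rewrite ltn_neqAle lP // andbT eq_sym; apply: contraTN lx2 => x1.
  have : x \in S by rewrite inE.
  by rewrite SE inE => /eqP->.
have /cards2P[u1 [u2 [u12 L1]]] : #|[set x | l x == 1]| == 2 by rewrite L12.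
have [t lt] : {t | \max_x l x = l t} by apply: eq_bigmax; apply: leq_trans n_ge3.
have l_le x : l x <= l t by rewrite -lt; apply: leq_bigmax.
(* The greatest level [l t] is the eccentricity of [v]: above 2 it gives [A_d], otherwise a [D]
   graph. *)
have [t2|t3] := leqP (l t) 2; last first.
  right; right; exists (l t) => //; exists G, v, u1, u2, (fun i => [set x | l x == i]).
  split; last exact: isomorphic_refl.
  by apply: level_A_structure => //; exists t.
apply: DE.
have lu1 : l u1 = 1 by apply/eqP; have := set21 u1 u2; rewrite -L1 inE.
have lu2 : l u2 = 1 by apply/eqP; have := set22 u1 u2; rewrite -L1 inE.
have lv : l v = 0 by apply/eqP; rewrite l0.
have vE x : l x = 1 -> sedge v x.
  by move/(parents_level1 lev) => E; have := set11 v; rewrite -E inE sedge_sym => /andP[].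
have [||w wN|D cD iso] := isomorphic_Dgraph _ _ u12 (vE _ lu1) (vE _ lu2) _.
- by rewrite eq_sym -l0 lu1.
- by rewrite eq_sym -l0 lu2.
- have lw : l w = 2.
    move: wN; rewrite -setUA -L1 !inE negb_or -l0.
    by move: (leq_trans (l_le w) t2); case: (l w) => [|[|[|]]].
  (* At least two parents inside the two-element level 1 means that both [u1] and [u2] are adjacent
     to [w]. *)
  have /eqP pE : parents l w == [set u1; u2].
    rewrite eqEcard cards2 u12 par2 ?lw // andbT -L1.
    by apply/subsetP=> x; rewrite !inE lw eqSS eq_sym => /andP[].
  have wu x : x \in [set u1; u2] -> sedge x w.
    by rewrite -pE inE sedge_sym => /andP[].
  split; [|exact/wu/set21|exact/wu/set22].
  by apply/negP; rewrite sedge_sym => /lE; rewrite lw lv.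
- by exists D => //; exists (sedge u1 u2).
Qed.
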